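(* Let $m'$ be an odd positive integer not divisible by $3$. There is no generalized bent function $f:\mathbb{Z}_3^2\to\mathbb{Z}_{2m'}$ with $G_f=\emptyset$, i.e. with $f(x)$ even for all $x\in\mathbb{Z}_3^2$.
   Context: A function $f:G\to\mathbb{Z}_m$ on a finite abelian group $G$ is a generalized bent function if $\left|\sum_{x\in G}\zeta_m^{f(x)}\chi(x)\right|^2=|G|$ for every character $\chi$ of $G$, where $\zeta_m$ is a primitive $m$-th root of unity. For $f:\mathbb{Z}_3^2\to\mathbb{Z}_{2m'}$, $G_f=\{x\in\mathbb{Z}_3^2: f(x)\text{ is odd}\}$ (parity is well defined since $2m'$ is even). *)

(* Defs.v *)
From mathcomp Require Import all_boot all_order all_algebra all_fingroup all_field all_character.

Set Implicit Arguments.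
Unset Strict Implicit.
Unset Printing Implicit Defensive.

Import GRing.Theory Num.Theory.
Local Open Scope ring_scope.

(* For abelian G the (irreducible) characters of G, i.e. the homomorphisms
   from G to the multiplicative group of the complex numbers, are the linear
   characters in the sense of character.v.  Their values, as well as zeta, are
   roots of unity, so algC plays the role of the complex numbers.
   The modulus must satisfy 1 < m for 'Z_m to be the integers mod m. *)
Definition generalized_bent (gT : finGroupType) (G : {group gT}) (m : nat)
    (zeta : algC) (f : gT -> 'Z_m) : Prop :=
  forall chi : 'CF(G), chi \is a linear_char ->
    `|\sum_(x in G) zeta ^+ f x * chi x| ^+ 2 = #|G|%:R.

Definition odd_support (m' : nat) (f : 'Z_3 * 'Z_3 -> 'Z_(2 * m')) :
    {set 'Z_3 * 'Z_3} :=
  [set x | odd (f x)].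

(* Main.v *)
Require Import Defs.
From mathcomp Require Import all_boot all_order all_algebra all_fingroup all_field all_character.
From mathcomp Require Import zify ring.

Set Implicit Arguments.
Unset Strict Implicit.
Unset Printing Implicit Defensive.

Import GRing.Theory Num.Theory.
Local Open Scope ring_scope.

(* The autocorrelation of [zeta ^+ f] at a nonzero shift vanishes when [f] is
   bent, by the orthogonality relations of characters.  When [f] is even, it is
   a sum of nine [m']-th roots of unity, and [m'] is prime to 6.  By (a special
   case of) a theorem of Lam and Leung, a vanishing sum of at most nine such
   roots has 0, 5 or 7 terms.  This is shown by induction on the order: let [p]
   be the largest prime factor of the order [p * m].  Averaging over the Galois
   automorphisms that fix the [m]-th roots shows that the partial sums over the
   [p] cosets of the [m]-th roots, once rotated into them, are all equal.  If
   they vanish, induction applies to each coset.  If not, no coset is empty, so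
   [p] is 5 or 7: for [p = 5] the order is 5 and all cosets have the same number
   of terms, while for [p = 7] a total of 8 or 9 terms would make a root of unity
   the sum of two or three others, which is impossible for orders prime to 6. *)

(** * Roots of unity and their short sums *)

Lemma sum_powers_unity_root (F : fieldType) (p : nat) (c : F) :
  c ^+ p = 1 -> \sum_(j < p) c ^+ j = (p * (c == 1))%:R.
Proof.
move=> cp1; have [->|c_neq1] := eqVneq c 1.
  by under eq_bigr do rewrite expr1n; rewrite sumr_const card_ord muln1.
have /eqP := subrX1 c p.
rewrite cp1 subrr eq_sym mulf_eq0 subr_eq0 (negPf c_neq1) /= => /eqP ->.
by rewrite muln0.
Qed.

Lemma conjC_unity_root (n : nat) (z : algC) :
  (0 < n)%N -> z ^+ n = 1 -> z^* = z^-1.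
Proof.
move=> n_gt0 zn1; have z1 : `|z| = 1.
  by apply: (pexpIrn n_gt0); rewrite ?nnegrE ?normr_ge0 ?ler01 // -normrX zn1 normr1 expr1n.
by rewrite invC_norm z1 expr1n invr1 mul1r.
Qed.

Lemma unity_root_neq0 (F : fieldType) (n : nat) (z : F) :
  (0 < n)%N -> z ^+ n = 1 -> z != 0.
Proof.
move=> n_gt0 /eqP; apply: contraTneq => ->.
by rewrite expr0n gtn_eqF // eq_sym oner_eq0.
Qed.

Lemma unity_root_coprime (F : fieldType) (a b : nat) (z : F) :
  coprime a b -> z ^+ a = 1 -> z ^+ b = 1 -> z = 1.
Proof.
case: a => [|a]; first by rewrite /coprime gcd0n => /eqP -> _; rewrite expr1.
move=> co_ab za1 zb1; have [k kz k_dvd] := prim_order_exists (ltn0Sn a) za1.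
have: (k %| gcdn a.+1 b)%N by rewrite dvdn_gcd k_dvd (prim_order_dvd kz) zb1 eqxx.
rewrite (eqP co_ab) dvdn1 => /eqP k1.
by rewrite -(prim_expr_order kz) k1 expr1.
Qed.

(* Conjugating [a + b = u] gives [a^-1 + b^-1 = u^-1]; together they force
   [a^2 + a b + b^2 = 0], hence [(a / b)^3 = 1]. *)
Lemma unity_root_neq_add2 (n : nat) (u a b : algC) :
  (0 < n)%N -> coprime n 3 -> u ^+ n = 1 -> a ^+ n = 1 -> b ^+ n = 1 ->
  a + b != u.
Proof.
move=> n_gt0 co_n3 un an bn; apply/eqP => abu.
have neq0 z := @unity_root_neq0 algC n z n_gt0.
have abuV : a^-1 + b^-1 = u^-1.
  by rewrite -!(conjC_unity_root n_gt0) // -rmorphD /= abu.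
have [[a0 b0] u0] := (neq0 a an, neq0 b bn, neq0 u un).
have q0 : a ^+ 2 + a * b + b ^+ 2 = 0.
  have -> : a ^+ 2 + a * b + b ^+ 2 =
     (a + b) * (a * b * (a^-1 + b^-1)) - a * b by field; rewrite ?a0 ?b0.
  by rewrite abuV abu mulrC mulfVK // subrr.
have ab1 : a / b = 1.
  apply: (unity_root_coprime co_n3); first by rewrite expr_div_n an bn divr1.
  rewrite expr_div_n; have -> : a ^+ 3 = b ^+ 3.
    apply/eqP; rewrite -subr_eq0.
    have -> : a ^+ 3 - b ^+ 3 = (a - b) * (a ^+ 2 + a * b + b ^+ 2) by ring.
    by rewrite q0 mulr0.
  by rewrite divff // expf_neq0.
have ab : a = b by apply: (mulIf (invr_neq0 b0)); rewrite ab1 divff.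
have /eqP : (b ^+ 2) *+ 3 = 0 by rewrite -q0 ab; ring.
by rewrite mulrn_eq0 expf_eq0 (negPf b0).
Qed.

(* Here conjugation gives [(a + b) (b + c) (c + a) = 0]. *)
Lemma unity_root_neq_add3 (n : nat) (u a b c : algC) :
  odd n -> u ^+ n = 1 -> a ^+ n = 1 -> b ^+ n = 1 -> c ^+ n = 1 ->
  a + b + c != u.
Proof.
move=> n_odd un an bn cn; apply/eqP => abcu.
have n_gt0 : (0 < n)%N by case: n n_odd {un an bn cn}.
have neq0 z := @unity_root_neq0 algC n z n_gt0.
have abcuV : a^-1 + b^-1 + c^-1 = u^-1.
  by rewrite -!(conjC_unity_root n_gt0) // -!rmorphD /= abcu.
have [[[a0 b0] c0] u0] := (neq0 a an, neq0 b bn, neq0 c cn, neq0 u un).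
(* As [n] is odd, [x = - y] would give [x ^+ n = -1]. *)
have add_neq0 (x y : algC) : x ^+ n = 1 -> y ^+ n = 1 -> x + y != 0.
  move=> xn yn; rewrite addr_eq0; apply/eqP => xy; move/eqP: xn.
  rewrite xy exprNn yn -signr_odd n_odd mulr1 expr1 -subr_eq0 -opprD oppr_eq0.
  by rewrite -mulr2n pnatr_eq0.
have : (a + b) * (b + c) * (c + a) = 0.
  have -> : (a + b) * (b + c) * (c + a) =
     (a + b + c) * (a * b * c * (a^-1 + b^-1 + c^-1)) - a * b * c.
    by field; rewrite ?a0 ?b0 ?c0.
  by rewrite abcuV abcu mulrC mulfVK // subrr.
by apply/eqP; rewrite !mulf_neq0 ?add_neq0.
Qed.

(** * Galois twists of vanishing sums *)

(* Summing over [j < p] the images of a sum of roots of unity under the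
   automorphisms [z |-> z ^+ (1 + m * j)] keeps only the [m]-th roots. *)
Lemma sum_twists_unity_root (F : fieldType) (p m : nat) (s : seq F) :
    all (p * m).-unity_root s ->
  \sum_(j < p) \sum_(z <- s) z ^+ (1 + m * j) =
    p%:R * \sum_(z <- s | z ^+ m == 1) z.
Proof.
move=> /allP s_pm; rewrite exchange_big mulr_sumr [RHS]big_mkcond /=.
apply: eq_big_seq => z /s_pm; rewrite unity_rootE mulnC exprM => /eqP zmp.
under eq_bigr do rewrite exprD expr1 exprM.
rewrite -mulr_sumr sum_powers_unity_root // mulrC.
by case: ifP => _; rewrite ?muln1 // muln0 mul0r.
Qed.

(** As [k] is prime to [n], some field automorphism raises every [n]-th root of unity to the power
    [k]. *)
Lemma sum_expr_coprime_eq0 (n k : nat) (s : seq algC) :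
    all n.-unity_root s -> coprime k n -> \sum_(z <- s) z = 0 ->
  \sum_(z <- s) z ^+ k = 0.
Proof.
move=> /allP s_n co_kn s0; have [u uE] := Qn_aut_exists co_kn.
have := congr1 u s0; rewrite rmorph0 rmorph_sum /= => us0; rewrite -[RHS]us0.
by apply: eq_big_seq => z /s_n /unity_rootP/uE ->.
Qed.

(** Each exponent [1 + m * j] is prime to [m], hence to [p], so every twist of the sum vanishes. *)
Lemma vanishing_sum_dvd (p m : nat) (s : seq algC) :
    (0 < p)%N -> (p %| m)%N -> all (p * m).-unity_root s ->
    \sum_(z <- s) z = 0 ->
  \sum_(z <- s | z ^+ m == 1) z = 0.
Proof.
move=> p_gt0 p_dvd_m s_pm s0.
have p_neq0 : p%:R != 0 :> algC by rewrite pnatr_eq0 -lt0n.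
apply: (mulfI p_neq0); rewrite -sum_twists_unity_root // mulr0.
apply: big1 => j _; apply: (sum_expr_coprime_eq0 s_pm) => //.
have co_m : coprime (1 + m * j) m by rewrite coprime_sym /coprime addnC mulnC gcdnMDl gcdn1.
by rewrite coprimeMr co_m (coprime_dvdr p_dvd_m co_m).
Qed.

(** Since [p] cannot divide [m], [k] is the only [j < p] for which [1 + m * j] is not prime to
    [p * m]; the other twists vanish. *)
Lemma vanishing_sum_coprime (p m k : nat) (s : seq algC) :
    prime p -> (k < p)%N -> (p %| 1 + m * k)%N -> all (p * m).-unity_root s ->
    \sum_(z <- s) z = 0 ->
  p%:R * \sum_(z <- s | z ^+ m == 1) z = \sum_(z <- s) z ^+ (1 + m * k).
Proof.
move=> p_pr k_lt p_dvd s_pm s0; rewrite -sum_twists_unity_root //.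
rewrite (bigD1 (Ordinal k_lt)) //= [X in _ + X]big1 ?addr0 // => j j_neq.
apply: (sum_expr_coprime_eq0 s_pm) => //.
have co_m : coprime (1 + m * j) m by rewrite coprime_sym /coprime addnC mulnC gcdnMDl gcdn1.
rewrite coprimeMr co_m andbT coprime_sym prime_coprime //.
apply: contra j_neq => p_dvdj; apply/eqP/val_inj => /=.
have p_n_m : ~~ (p %| m)%N.
  apply: contraL p_dvd => p_m; rewrite dvdn_addl ?dvdn_mulr // dvdn1.
  by rewrite gtn_eqF ?prime_gt1.
have aux a b : (a <= b)%N -> (b < p)%N -> (p %| 1 + m * a)%N ->
    (p %| 1 + m * b)%N -> a = b.
  move=> ab bp pa; rewrite -(subnKC ab) mulnDr addnA dvdn_addr //.
  rewrite Euclid_dvdM // (negPf p_n_m) /=; case: (posnP (b - a)) => [|d_gt0].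
    by move=> ->; rewrite addn0.
  by move/(dvdn_leq d_gt0); lia.
case: (leqP j k) => [jk|/ltnW kj]; first exact: aux.
by apply/esym/aux.
Qed.

Lemma exists_dvd_addM (p m : nat) :
  prime p -> ~~ (p %| m)%N -> exists2 k, (k < p)%N & (p %| 1 + m * k)%N.
Proof.
move=> p_pr p_n_m; have p_gt0 := prime_gt0 p_pr.
have m_gt0 : (0 < m)%N by case: m p_n_m => //; rewrite dvdn0.
case: (egcdnP p m_gt0) => u v uv _.
have g1 : gcdn m p = 1%N by apply/eqP; rewrite -/(coprime m p) coprime_sym prime_coprime.
(* Bezout gives [u * m = v * p + 1], and [p.-1 * u] stands for [- u] modulo [p]. *)
exists ((p.-1 * u) %% p)%N; first by rewrite ltn_mod.
rewrite /dvdn -modnDmr modnMmr modnDmr; apply/dvdnP.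
exists (p.-1 * v + 1)%N; move: uv; rewrite g1; case: p p_gt0 {p_pr p_n_m g1} => // q _ /=.
nia.
Qed.

(** * Splitting a vanishing sum into cosets *)

Definition unity_coset (F : fieldType) (eps : F) (m : nat) (s : seq F) (i : nat) :=
  [seq z <- [seq z / eps ^+ i | z <- s] | z ^+ m == 1].

Lemma unity_coset_unity_root (F : fieldType) (eps : F) m s i :
  all m.-unity_root (unity_coset eps m s i).
Proof. by apply/allP => z; rewrite mem_filter unity_rootE => /andP[]. Qed.

(** The [m]-th power of an entry is a [p]-th root of unity, so it is [(eps ^+ m) ^+ i] for exactly
    one [i < p]: the entry is counted in one coset only. *)
Lemma sum_size_unity_coset (F : fieldType) (eps : F) (p m : nat) (s : seq F) :
    p.-primitive_root (eps ^+ m) -> all (p * m).-unity_root s ->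
  (\sum_(i < p) size (unity_coset eps m s i) = size s)%N.
Proof.
move=> epsP /allP s_pm.
under eq_bigr do rewrite size_filter -sum1_count big_map big_mkcond.
rewrite exchange_big /= -sum1_size; apply: eq_big_seq => z /s_pm.
rewrite unity_rootE mulnC exprM => /eqP/(prim_rootP epsP)[i zi].
have eps_neq0 : eps ^+ m != 0.
  exact: unity_root_neq0 (prim_order_gt0 epsP) (prim_expr_order epsP).
have condE (j : 'I_p) : ((z / eps ^+ j) ^+ m == 1) = (j == i).
  have epsj := expf_neq0 j eps_neq0.
  rewrite expr_div_n -exprM mulnC exprM zi -[1](divff epsj).
  rewrite (inj_eq (mulIf (invr_neq0 epsj))) (eq_prim_root_expr epsP).
  by rewrite !modn_small // eq_sym.
by under eq_bigr do rewrite condE; rewrite -big_mkcond /= big_pred1_eq.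
Qed.

(* The common value vanishes when [p %| m], since the relations between the
   powers of a primitive [(p * m)]-th root over the [m]-th roots are then trivial. *)
Lemma vanishing_sum_split (p m : nat) (s : seq algC) :
    prime p -> (0 < m)%N -> all (p * m).-unity_root s -> \sum_(z <- s) z = 0 ->
  exists (t : nat -> seq algC) (c : algC),
    [/\ forall i, all m.-unity_root (t i),
        forall i, (i < p)%N -> \sum_(z <- t i) z = c,
        (\sum_(i < p) size (t i) = size s)%N
      & (p %| m)%N -> c = 0].
Proof.
move=> p_pr m_gt0 s_pm s0; have p_gt0 := prime_gt0 p_pr.
have pm_gt0 : (0 < p * m)%N by rewrite muln_gt0 p_gt0.
have shift (eps : algC) i : eps ^+ (p * m) = 1 ->
    all (p * m).-unity_root [seq z / eps ^+ i | z <- s] /\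
    \sum_(z <- [seq z / eps ^+ i | z <- s]) z = 0.
  move=> eps1; split; last by rewrite big_map -mulr_suml s0 mul0r.
  apply/allP => _ /mapP[z /(allP s_pm) /unity_rootP zpm ->].
  by rewrite unity_rootE expr_div_n -(exprM eps) (mulnC i) (exprM eps) eps1 expr1n divr1 zpm.
have [p_dvd | p_ndvd] := boolP (p %| m)%N.
  have [eps epsP] := C_prim_root_exists pm_gt0.
  have epsmP : p.-primitive_root (eps ^+ m).
    by have:= dvdn_prim_root epsP (dvdn_mulr m (dvdnn p)); rewrite mulKn.
  exists (unity_coset eps m s), 0; split=> // [i|i _|].
  - exact: unity_coset_unity_root.
  - have [sh1 sh2] := shift eps i (prim_expr_order epsP).
    by rewrite big_filter (vanishing_sum_dvd p_gt0 p_dvd).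
  - exact: sum_size_unity_coset.
(* Here a [p]-th root can represent the cosets. Rotation by it disappears in the surviving twist,
   whose exponent is a multiple of [p], so the result does not depend on [i]. *)
have [eps epsP] := C_prim_root_exists p_gt0.
have epsmP : p.-primitive_root (eps ^+ m).
  by rewrite (prim_root_exp_coprime _ epsP) coprime_sym prime_coprime.
have [k k_lt p_k] := exists_dvd_addM p_pr p_ndvd.
exists (unity_coset eps m s), (p%:R^-1 * \sum_(z <- s) z ^+ (1 + m * k)).
split=> [i|i _||/idPn//]; first exact: unity_coset_unity_root.
  have eps1 : eps ^+ (p * m) = 1 by rewrite exprM (prim_expr_order epsP) expr1n.
  have [sh1 sh2] := shift eps i eps1.
  rewrite big_filter; apply: (canRL (mulKf _)); first by rewrite pnatr_eq0 -lt0n.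
  rewrite (vanishing_sum_coprime p_pr k_lt p_k sh1 sh2) big_map.
  apply: eq_bigr => z _; rewrite expr_div_n -(exprM eps) (mulnC i) (exprM eps).
  have /eqP -> : eps ^+ (1 + m * k) == 1 by rewrite -(prim_order_dvd epsP).
  by rewrite expr1n divr1.
exact: sum_size_unity_coset.
Qed.

(** * Possible sizes of vanishing sums *)

(** Two nonzero terms would already add up to at least 10. *)
Lemma sum_leq9_in057 (I : finType) (a : I -> nat) :
    (forall i, a i <= 9 -> a i \in [:: 0; 5; 7])%N ->
    (\sum_i a i <= 9)%N -> (\sum_i a i)%N \in [:: 0; 5; 7]%N.
Proof.
move=> a057 le9.
have [/existsP[i ai]|] := boolP [exists i, a i != 0%N]; last first.
  by rewrite negb_exists => /forallP a0; rewrite big1 // => i _; apply/eqP/negPn/a0.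
move: le9; rewrite (bigD1 i) //= => le9.
have a_i : a i \in [:: 0; 5; 7]%N by apply: a057; lia.
have {}a057 j : (a j <= 9)%N -> a j = 0%N \/ (5 <= a j)%N.
  by move/a057; rewrite !inE => /or3P[] /eqP ->; [left|right|right].
rewrite big1 ?addn0 // => j ji; move: le9; rewrite (bigD1 j) //=.
move: (a057 i) (a057 j) ai; lia.
Qed.

Lemma sum_ge_card (I : finType) (P : pred I) (a : I -> nat) (k : nat) :
  (forall i, P i -> k <= a i)%N -> (#|P| * k <= \sum_(i | P i) a i)%N.
Proof.
by move=> ak; rewrite -sum_nat_const; apply: leq_sum.
Qed.

Lemma vanishing_sum_size (n : nat) (s : seq algC) :
    (0 < n)%N -> coprime n 6 -> all n.-unity_root s -> \sum_(z <- s) z = 0 ->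
  (size s <= 9 -> size s \in [:: 0; 5; 7])%N.
Proof.
elim/ltn_ind: n s => n IHn s n_gt0 co_n6 s_n s0 s9.
have [n1|n_gt1] := leqP n 1.
  have {}n1 : n = 1%N by lia.
  move: s0; rewrite (eq_big_seq (fun=> 1)); last first.
    by move=> z /(allP s_n); rewrite n1 unity_rootE expr1 => /eqP.
  by rewrite big_const_seq count_predT iter_addr_0 => /eqP; rewrite pnatr_eq0 inE => ->.
pose p := max_pdiv n; have p_pr : prime p := max_pdiv_prime n_gt1.
have p_dvd : (p %| n)%N := max_pdiv_dvd n.
pose m := (n %/ p)%N; have nE : n = (p * m)%N by rewrite mulnC divnK.
have m_gt0 : (0 < m)%N by move: n_gt0; rewrite nE muln_gt0 => /andP[].
have m_lt : (m < n)%N by rewrite ltn_Pdiv ?prime_gt1.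
have co_m6 : coprime m 6 by move: co_n6; rewrite nE coprimeMl => /andP[].
have co_p6 : coprime p 6 by move: co_n6; rewrite nE coprimeMl => /andP[].
rewrite nE in s_n.
have [t [c [t_m t_c t_size c0]]] := vanishing_sum_split p_pr m_gt0 s_n s0.
rewrite -t_size in s9 *.
have [c_eq0|c_neq0] := eqVneq c 0.
  by apply: sum_leq9_in057 => // i; apply: (IHn m) => //; rewrite t_c.
have t_gt0 (i : 'I_p) : (0 < size (t i))%N.
  rewrite lt0n size_eq0; apply: contra c_neq0 => /eqP ti.
  by rewrite -(t_c i) // ti big_nil.
have p_le9 : (p <= 9)%N.
  by apply: leq_trans s9; rewrite -{1}(card_ord p) -[#|_|]muln1 sum_ge_card.
have {p_le9} : p = 5%N \/ p = 7%N.
  by move: (p) p_pr co_p6 p_le9 => [|[|[|[|[|[|[|[|[|[|]]]]]]]]]] //; auto.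
case=> p57.
  (* A prime factor of [m] is prime to 6 and at most 5 by maximality of [p], hence equal to [p]; but
     [p] dividing [m] forces [c = 0]. *)
  have m1 : m = 1%N.
    apply/eqP; rewrite eqn_leq m_gt0 andbT leqNgt; apply/negP => m_gt1.
    have q_pr := pdiv_prime m_gt1; have q_dvd := pdiv_dvd m.
    have q_le : (pdiv m <= p)%N.
      apply: max_pdiv_max; rewrite mem_primes q_pr n_gt0 nE.
      by rewrite dvdn_mull.
    have co_q6 := coprime_dvdl q_dvd co_m6.
    have qp : pdiv m = p.
      by move: (pdiv m) q_pr co_q6 q_le; rewrite p57 => [[|[|[|[|[|[|]]]]]]].
    by case/eqP: c_neq0; apply: c0; rewrite -qp.
  have t_eq (i : 'I_p) : size (t i) = size (t 0%N).
    have sumE j : \sum_(z <- t j) z = (size (t j))%:R.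
      rewrite (eq_big_seq (fun=> 1)); last first.
        by move=> z /(allP (t_m j)); rewrite m1 unity_rootE expr1 => /eqP.
      by rewrite big_const_seq count_predT iter_addr_0.
    by apply/eqP; rewrite -(eqr_nat algC) -!sumE !t_c ?prime_gt0.
  move: s9; rewrite (eq_bigr _ (fun i _ => t_eq i)) sum_nat_const card_ord p57.
  by case: (size _) => [|[|k]] //; lia.
(* Seven cosets of at least two terms each would need 14 terms. *)
have /existsP[i /eqP ti1] : [exists i : 'I_p, size (t i) == 1%N].
  apply: contraLR s9; rewrite negb_exists -ltnNge => /forallP t1.
  apply: leq_trans (sum_ge_card (k := 2) _); first by rewrite card_ord p57.
  by move=> i _; rewrite ltn_neqAle eq_sym t1 t_gt0.
have [/forallP t1|] := boolP [forall i : 'I_p, size (t i) == 1%N].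
  have -> : (\sum_(j < p) size (t j) = p)%N.
    rewrite -[RHS]card_ord -sum1_card.
    by apply: eq_bigr => j _; apply/eqP.
  by rewrite p57.
rewrite negb_forall => /existsP[j tj1].
(* The other six cosets take at least six of the at most nine terms. *)
have tj3 : (size (t j) <= 3)%N.
  move: s9; rewrite (bigD1 j) //=.
  have /(sum_ge_card (k := 1)) : forall i : 'I_p, i != j -> (1 <= size (t i))%N by [].
  rewrite cardC1 card_ord => le_sum /(leq_trans (leq_add (leqnn _) le_sum)).
  by move: (size _) => k; rewrite p57; lia.
have n_odd : odd m by rewrite -coprime2n coprime_sym (coprime_dvdr _ co_m6).
have co_m3 : coprime m 3 by rewrite (coprime_dvdr _ co_m6).
have := t_c i (ltn_ord i); rewrite -(t_c j (ltn_ord j)).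
move: ti1 tj3 tj1 (t_gt0 j) (t_m i) (t_m j).
case: (t i) => [|u []] //= _.
case: (t j) => [|x [|y [|z []]]] //= _ _ _;
  rewrite !andbT !unity_rootE !big_cons !big_nil !addr0.
  move=> /eqP um /andP[/eqP xm /eqP ym] /esym/eqP.
  by rewrite (negPf (unity_root_neq_add2 m_gt0 co_m3 um xm ym)).
move=> /eqP um /and3P[/eqP xm /eqP ym /eqP zm] /esym/eqP; rewrite addrA.
by rewrite (negPf (unity_root_neq_add3 n_odd um xm ym zm)).
Qed.

(** * Bent functions and their autocorrelation *)

(** Weight the flatness equation of each [chi] by [chi a] and sum over all [chi]. The constant side
    vanishes because [a] is not the identity; on the other side orthogonality keeps only the pairs
    with [y = x * a]. *)
Lemma autocorrelation_eq0 (gT : finGroupType) (G : {group gT}) (F : gT -> algC)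
    (c : algC) (a : gT) :
    abelian G -> a \in G -> a != 1%g ->
    (forall chi : 'CF(G), chi \is a linear_char ->
      `|\sum_(x in G) F x * chi x| ^+ 2 = c) ->
  \sum_(x in G) F x * (F (x * a)%g)^* = 0.
Proof.
move=> abG aG a_neq1 flat; have irrG := char_abelianP _ abG.
have orth x y : x \in G -> y \in G ->
    \sum_i 'chi[G]_i x * ('chi_i y)^* = (#|G| * (x == y))%:R.
  move=> xG yG; rewrite second_orthogonality_relation //.
  have -> : ('C_G[x] = G)%g.
    apply/setIidPl/subsetP => g gG; rewrite cent1E.
    by rewrite (centsP abG _ gG _ xG).
  have -> : (y ^: G = [set y])%g.
    apply/setP=> z; apply/imsetP/set1P => [[g gG ->]|->].
      by rewrite conjgE (centsP abG _ yG _ gG) mulKg.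
    by exists 1%g; rewrite ?conjg1.
  by rewrite inE -mulr_natr natrM.
have card_neq0 : #|G|%:R != 0 :> algC by rewrite pnatr_eq0 -lt0n cardG_gt0.
apply: (mulfI card_neq0); rewrite mulr0.
transitivity (\sum_i c * ('chi[G]_i a * ('chi_i 1%g)^*)); last first.
  by rewrite -mulr_sumr orth // (negPf a_neq1) muln0 mulr0.
transitivity (\sum_(x in G) \sum_(y in G)
    \sum_i F x * (F y)^* * ('chi[G]_i (x * a)%g * ('chi_i y)^*)).
  rewrite mulr_sumr; apply: eq_bigr => x xG.
  rewrite (bigD1 (x * a)%g) ?groupM //= [X in _ + X]big1 ?addr0 => [|y /andP[yG y_neq]].
    by rewrite -mulr_sumr orth ?groupM // eqxx muln1 mulrC.
  by rewrite -mulr_sumr orth ?groupM // eq_sym (negPf y_neq) muln0 mulr0.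
under eq_bigr do rewrite exchange_big.
rewrite exchange_big; apply: eq_bigr => i _ /=.
rewrite -(flat _ (irrG i)) normCK rmorph_sum /= mulr_suml mulr_suml.
apply: eq_bigr => x xG; rewrite mulr_sumr mulr_suml; apply: eq_bigr => y yG.
rewrite (lin_charM (irrG i)) // (lin_char1 (irrG i)) conjC1 rmorphM /=; ring.
Qed.

Theorem lemma4p4 (m' : nat) (m'_gt0 : (0 < m')%N) (m'_odd : odd m')
    (m'_n3 : ~~ (3 %| m')%N) (zeta : algC)
    (zetaP : (2 * m').-primitive_root zeta) :
  ~ exists f : 'Z_3 * 'Z_3 -> 'Z_(2 * m'),
      generalized_bent [set: 'Z_3 * 'Z_3]%G zeta f /\ odd_support f = set0.
Proof.
case=> f [bent_f f_even].
have F_unity x : (zeta ^+ f x) ^+ m' = 1.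
  have : x \notin odd_support f by rewrite f_even inE.
  rewrite inE -dvdn2 => /dvdnP[k ->].
  by rewrite -exprM -mulnA mulnC exprM (prim_expr_order zetaP) expr1n.
have co6 : coprime m' 6.
  by rewrite (coprimeMr _ 2 3) coprimen2 m'_odd coprime_sym prime_coprime.
(* Any nonzero shift would do; the group law [*] below is addition in ['Z_3 * 'Z_3]. *)
pose a : 'Z_3 * 'Z_3 := (1, 0).
have abT : abelian [set: 'Z_3 * 'Z_3].
  by apply/centsP => x _ y _; congr pair; exact: (@addrC 'Z_3).
have := autocorrelation_eq0 (a := a) abT (in_setT _) _ bent_f => /(_ isT).
pose s := [seq zeta ^+ f x * (zeta ^+ f (x * a)%g)^* | x <- enum [set: 'Z_3 * 'Z_3]].
have s_size : size s = 9%N by rewrite size_map -cardE cardsT card_prod !card_ord.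
rewrite -big_enum -(big_map _ predT id) -/s /= => s0.
have s_m' : all m'.-unity_root s.
  apply/allP => _ /mapP[x _ ->].
  by rewrite unity_rootE exprMn -rmorphXn /= !F_unity conjC1 mulr1.
(* The contradiction is that 9 is none of 0, 5, 7. *)
by have := vanishing_sum_size m'_gt0 co6 s_m' s0; rewrite s_size => /(_ isT).
Qed.
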